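(* Let $m\ge 2$ be an integer, let $F$ be a graph obtained from the complete bipartite graph $K_{2m,2m}$ (both parts of size $2m$) by deleting one edge (keeping all vertices), and put $n=4m$ (the order of $F$) and $k=3m$. Then $F$ and $\overline F$ are both connected, $$\mu_k(F)\,\mu_k(\overline F)=n(n-k),$$ and neither $F$ nor $\overline F$ is isomorphic to a join $K_k\vee H$ in which $H$ is a graph with $n-k$ vertices and at least $k+1$ connected components.
   Context: All graphs are finite and simple. For a graph $G$ of order $n$, $\overline G$ denotes its complement, and $L(G)=D(G)-A(G)$ denotes its Laplacian matrix, where $D(G)$ is the diagonal matrix of vertex degrees and $A(G)$ is the adjacency matrix. The eigenvalues of $L(G)$, counted with multiplicity, are written in non-increasing order as $\mu_1(G)\ge\mu_2(G)\ge\cdots\ge\mu_n(G)=0$. $K_k$ is the complete graph on $k$ vertices. The join $G_1\vee G_2$ of two graphs is obtained from their disjoint union by adding all edges between vertices of $G_1$ and vertices of $G_2$. *)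

(* Defs.v *)
From mathcomp Require Import all_boot all_order all_algebra.

Set Implicit Arguments.
Unset Strict Implicit.
Unset Printing Implicit Defensive.

Import Order.TTheory GRing.Theory Num.Theory.
Local Open Scope ring_scope.

Record sgraph := SGraph {
  vertex :> finType;
  adj : rel vertex;
  adj_sym : symmetric adj;
  adj_irrefl : irreflexive adj }.

Definition isomorphic (G H : sgraph) : Prop :=
  exists2 f : G -> H, bijective f & forall x y : G, adj (f x) (f y) = adj x y.

Definition connected (G : sgraph) : Prop :=
  (0 < #|G|)%N /\ forall x y : G, connect (@adj G) x y.

Definition num_components (G : sgraph) : nat := n_comp (@adj G) predT.

Section Complement.
Variable G : sgraph.
Definition compl_adj : rel G := fun x y => (x != y) && ~~ adj x y.
Lemma compl_adj_sym : symmetric compl_adj.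
Proof. by move=> x y; rewrite /compl_adj eq_sym adj_sym. Qed.
Lemma compl_adj_irrefl : irreflexive compl_adj.
Proof. by move=> x; rewrite /compl_adj eqxx. Qed.
Definition complement : sgraph := SGraph compl_adj_sym compl_adj_irrefl.
End Complement.

Section DeleteEdge.
Variables (G : sgraph) (a b : G).
Definition del_edge_adj : rel G :=
  fun x y => adj x y && ([set x; y] != [set a; b]).
Lemma del_edge_adj_sym : symmetric del_edge_adj.
Proof. by move=> x y; rewrite /del_edge_adj adj_sym setUC. Qed.
Lemma del_edge_adj_irrefl : irreflexive del_edge_adj.
Proof. by move=> x; rewrite /del_edge_adj adj_irrefl. Qed.
Definition del_edge : sgraph := SGraph del_edge_adj_sym del_edge_adj_irrefl.
End DeleteEdge.

Section Join.
Variables G H : sgraph.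
Definition join_adj : rel (G + H)%type := fun u v =>
  match u, v with
  | inl x, inl y => adj x y
  | inr x, inr y => adj x y
  | _, _ => true
  end.
Lemma join_adj_sym : symmetric join_adj.
Proof. by case=> x [] y //=; rewrite adj_sym. Qed.
Lemma join_adj_irrefl : irreflexive join_adj.
Proof. by case=> x /=; rewrite adj_irrefl. Qed.
Definition join : sgraph := SGraph join_adj_sym join_adj_irrefl.
End Join.

Section Complete.
Variable k : nat.
Definition complete_adj : rel 'I_k := fun x y => x != y.
Lemma complete_adj_sym : symmetric complete_adj.
Proof. by move=> x y; rewrite /complete_adj eq_sym. Qed.
Lemma complete_adj_irrefl : irreflexive complete_adj.
Proof. by move=> x; rewrite /complete_adj eqxx. Qed.
Definition complete : sgraph := SGraph complete_adj_sym complete_adj_irrefl.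
End Complete.

Section CompleteBipartite.
Variables p q : nat.
Definition bipartite_adj : rel ('I_p + 'I_q)%type := fun u v =>
  match u, v with
  | inl _, inr _ | inr _, inl _ => true
  | _, _ => false
  end.
Lemma bipartite_adj_sym : symmetric bipartite_adj.
Proof. by case=> x []. Qed.
Lemma bipartite_adj_irrefl : irreflexive bipartite_adj.
Proof. by case. Qed.
Definition complete_bipartite : sgraph :=
  SGraph bipartite_adj_sym bipartite_adj_irrefl.
End CompleteBipartite.

Definition degree (G : sgraph) (x : G) : nat := #|[set y | adj x y]|.

Section Laplacian.
Variables (C : numClosedFieldType) (G : sgraph).

Definition adj_mx : 'M[C]_#|G| :=
  \matrix_(i, j) (adj (enum_val i) (enum_val j))%:R.
Definition degree_mx : 'M[C]_#|G| :=
  diag_mx (\row_i (degree (enum_val i))%:R).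
Definition laplacian : 'M[C]_#|G| := degree_mx - adj_mx.
End Laplacian.

(* The roots of the characteristic polynomial of [A], with multiplicity.  The
   order of [C] is total only on real elements, so the sequence is guaranteed
   to be non-increasing only when all the eigenvalues are real; this holds for
   Laplacians, see [laplacian_eigenvalues_sorted]. *)
Definition eigenvalues (C : numClosedFieldType) n (A : 'M[C]_n) : seq C :=
  sort (fun x y => y <= x) (sval (closed_field_poly_normal (char_poly A))).

(* Indexed from 1: [mu C G 1] is the largest Laplacian eigenvalue. *)
Definition mu (C : numClosedFieldType) (G : sgraph) (k : nat) : C :=
  (eigenvalues (laplacian C G))`_k.-1.

Lemma char_poly_eigenvalues (C : numClosedFieldType) n (A : 'M[C]_n) :
  char_poly A = \prod_(z <- eigenvalues A) ('X - z%:P).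
Proof.
rewrite /eigenvalues; case: closed_field_poly_normal => r /= Dr.
rewrite (perm_big r) /=; last by rewrite perm_sort.
by rewrite {1}Dr (monicP (char_poly_monic A)) scale1r.
Qed.

Lemma size_eigenvalues (C : numClosedFieldType) n (A : 'M[C]_n) :
  size (eigenvalues A) = n.
Proof.
have := size_char_poly A.
by rewrite char_poly_eigenvalues size_prod_XsubC => -[].
Qed.

Lemma laplacian_hermsym (C : numClosedFieldType) (G : sgraph) :
  laplacian C G \is hermsymmx.
Proof.
apply: realsym_hermsym.
  apply/is_hermitianmxP; rewrite expr0 scale1r map_mx_id //.
  apply/matrixP => i j; rewrite !mxE adj_sym.
  by rewrite [j == i]eq_sym; case: eqP => [->|].
by apply/mxOverP => i j; rewrite !mxE -mulrnA realB ?realn.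
Qed.

Lemma eigenvalues_hermsym_real (C : numClosedFieldType) n (A : 'M[C]_n) :
  A \is hermsymmx -> {in eigenvalues A, forall z, z \is Num.real}.
Proof.
move=> hA z zA; have /orthomx_spectralP A_eq := hermitian_normalmx hA.
have : eigenvalue A z.
  by rewrite eigenvalue_root_char char_poly_eigenvalues root_prod_XsubC.
case/eigenvalueP => v vA v_neq0; set P := spectralmx A in A_eq.
have Pu : P \in unitmx by exact: spectral_unit.
pose w := v *m invmx P.
have w_neq0 : w != 0.
  apply: contra_neq v_neq0 => w0.
  by rewrite -[v](mulmxKV Pu) -/w w0 mul0mx.
have wD : w *m diag_mx (spectral_diag A) = z *: w.
  apply: (can_inj (mulmxK Pu)).
  by rewrite -scalemxAl mulmxKV // -vA [in RHS]A_eq !mulmxA.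
clearbody w; have [j wj] := rV0Pn _ w_neq0.
have /rowP/(_ j) := wD; rewrite mul_mx_diag !mxE [z * _]mulrC.
move=> /(mulfI wj) <-.
exact: (mxOverP (hermitian_spectral_diag_real hA)).
Qed.

Lemma laplacian_eigenvalues_sorted (C : numClosedFieldType) (G : sgraph) :
  sorted (fun x y => y <= x) (eigenvalues (laplacian C G)).
Proof.
have real_ev := eigenvalues_hermsym_real (laplacian_hermsym C G).
apply: (@sort_sorted_in _ [pred z : C | z \is Num.real]).
  by move=> x y xR yR; exact: real_leVge.
by apply/allP => z zr; apply: real_ev; rewrite mem_sort.
Qed.

(* Main.v *)
Require Import Defs.
From mathcomp Require Import all_boot all_order all_algebra zify ring.

Set Implicit Arguments.
Unset Strict Implicit.
Unset Printing Implicit Defensive.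

Import Order.TTheory GRing.Theory Num.Theory.
Local Open Scope ring_scope.

(** The interest of this family is that the k-th eigenvalue of both graphs can
be found without computing their spectra.  Write s = 2m for the size of a part
of F and J for the all-ones matrix.  Then [mu_k = s] for F and for its
complement, so that the product of the two is [s ^ 2 = 4m * m = n * (n - k)].

Let u and v be the indicator columns of the two parts, and w the difference of
the indicators of the ends a and b of the deleted edge.  Deleting an edge
subtracts [w *m w^T] from the Laplacian, so that
[L(F) - s = - (u *m v^T + v *m u^T + w *m w^T)]; as the Laplacians of F and of
its complement add up to [n - J] and as [J = (u + v) *m (u + v)^T], also
[L(complement F) - s = w *m w^T - u *m u^T - v *m v^T].
([laplacian_minus_edge], [laplacian_compl_minus_edge].)  Both matrices have
rank at most 3, and a Laplacian is Hermitian, hence diagonalizable, so that all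
but at most 3 of the n eigenvalues of either graph equal s.

It remains to locate the exceptional eigenvalues.  Each graph has a vertex of
degree s with a neighbour, that is, its Laplacian has a diagonal entry s
in a row with a nonzero off-diagonal entry.  Such an entry cannot be the
largest eigenvalue ([eigenvalue_gt_diag]), so at least one of the exceptional
eigenvalues lies above s, and at most two lie below.  Hence s occupies every
rank from 4 to n - 2, and [4 <= 3m <= 4m - 2] as soon as [m >= 2].

The last claim is a matter of size: a graph on [n - k = m] vertices cannot
have [k + 1 = 3m + 1] components. *)

(** * Eigenvalues of Hermitian matrices *)

Lemma char_poly_similar (R : comUnitRingType) n (P A : 'M[R]_n) :
  P \in unitmx -> char_poly (invmx P *m A *m P) = char_poly A.
Proof.
move=> Pu; rewrite /char_poly.
have -> : char_poly_mx (invmx P *m A *m P) =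
    map_mx polyC (invmx P) *m char_poly_mx A *m map_mx polyC P.
  rewrite /char_poly_mx mulmxBr mulmxBl -!map_mxM; congr (_ - _).
  by rewrite scalar_mxC -mulmxA -map_mxM mulVmx // map_mx1 mulmx1.
rewrite !det_mulmx mulrAC -det_mulmx -map_mxM mulVmx //.
by rewrite map_mx1 det1 mul1r.
Qed.

(** Identifies the roots of the characteristic polynomial, with their
multiplicities, with the diagonal entries given by the spectral theorem. *)
Lemma eigenvalues_hermsym (C : numClosedFieldType) n (A : 'M[C]_n) :
  A \is hermsymmx ->
  perm_eq (eigenvalues A) [seq spectral_diag A 0 i | i : 'I_n].
Proof.
move=> hA; apply: prod_XsubC_eq; rewrite -char_poly_eigenvalues.
have /orthomx_spectralP A_eq := hermitian_normalmx hA.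
rewrite [in LHS]A_eq char_poly_similar ?spectral_unit //.
rewrite char_poly_trig ?diag_mx_is_trig // big_image /=.
by apply: eq_bigr => i _; rewrite mxE eqxx mulr1n.
Qed.

(** The rows and columns of the nonzero diagonal entries cut out an invertible
submatrix. *)
Lemma leq_rank_diag_mx (K : fieldType) n (d : 'rV[K]_n) :
  (#|[pred i | (d 0 i != 0)%R]| <= \rank (diag_mx d))%N.
Proof.
set I := [pred i | _]; pose f := @enum_val _ I.
have subE : mxsub f f (diag_mx d) =
    rowsub f 1%:M *m diag_mx d *m colsub f 1%:M.
  by rewrite mul_rowsub_mx mul1mx mulmx_colsub mulmx1 -mxsubcr.
have diagE : mxsub f f (diag_mx d) = diag_mx (\row_i d 0 (f i)).
  by apply/matrixP => i j; rewrite !mxE (inj_eq enum_val_inj).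
have /mxrank_unit <- : mxsub f f (diag_mx d) \in unitmx.
  rewrite diagE unitmxE det_diag unitfE prodf_seq_neq0.
  by apply/allP => i _; rewrite mxE /=; apply: (enum_valP i).
by rewrite subE (leq_trans (mxrankM_maxl _ _)) ?mxrankM_maxr.
Qed.

(** Algebraic and geometric multiplicities agree for a Hermitian matrix, so the
rank of [A - z] counts the eigenvalues other than [z]; this direction of the
equality is the one that produces a multiple eigenvalue. *)
Lemma count_eigenvalues_neq (C : numClosedFieldType) n (A : 'M[C]_n) (z : C) :
  A \is hermsymmx ->
  (count (predC1 z) (eigenvalues A) <= \rank (A - z%:M)%R)%N.
Proof.
move=> hA; have /orthomx_spectralP A_eq := hermitian_normalmx hA.
have Pu := spectral_unit A; set P := spectralmx A in A_eq Pu.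
have -> : A - z%:M = invmx P *m diag_mx (spectral_diag A - const_mx z) *m P.
  rewrite linearB /= mulmxBr mulmxBl -A_eq diag_const_mx.
  by rewrite scalar_mxC -mulmxA mulVmx ?mulmx1.
rewrite mxrankMfree ?row_free_unit // -mxrank_tr trmx_mul.
rewrite mxrankMfree ?row_free_unit ?unitmx_tr ?unitmx_inv // mxrank_tr.
apply: leq_trans (leq_rank_diag_mx _).
rewrite (permP (eigenvalues_hermsym hA)) /image_mem count_map.
rewrite -size_filter cardE /enum_mem -filter_predI.
rewrite !size_filter /= leq_eqVlt; apply/orP; left; apply/eqP.
by apply: eq_count => i; rewrite /= !inE /= !mxE subr_eq0 andbT.
Qed.

(** Otherwise [A i i - A] would be positive semidefinite.  In terms of the
spectral decomposition, [A i i] is the average of the eigenvalues with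
weights [`|P k i| ^+ 2], so an average that dominates all eigenvalues forces
each of them to equal [A i i] wherever its weight is nonzero.  But then the
i-th basis vector is an eigenvector, and [A i j = 0]. *)
Lemma eigenvalue_gt_diag (C : numClosedFieldType) n (A : 'M[C]_n) i j :
  A \is hermsymmx -> i != j -> A i j != 0 ->
  exists2 z, z \in eigenvalues A & A i i < z.
Proof.
move=> hA neq_ij Aij; have perm_ev := eigenvalues_hermsym hA.
have /orthomx_spectralP A_eq := hermitian_normalmx hA.
have Puni := spectral_unitarymx A; have Pu := spectral_unit A.
have dR k : spectral_diag A 0 k \is Num.real.
  exact: (mxOverP (hermitian_spectral_diag_real hA)).
have AiiR : A i i \is Num.real.
  have /is_hermitianmxP/matrixP/(_ i i) := hA.
  by rewrite !mxE expr0 mul1r => /esym/CrealP.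
set P := spectralmx A in A_eq Puni Pu.
set d := spectral_diag A in A_eq dR perm_ev.
have entry x y : A x y = \sum_k (P k x)^* * d 0 k * P k y.
  rewrite {1}A_eq invmx_unitary // mxE; apply: eq_bigr => k _.
  by rewrite mul_mx_diag !mxE.
have ortho x y : \sum_k (P k x)^* * P k y = (x == y)%:R.
  have /matrixP/(_ x y) := mulVmx Pu; rewrite invmx_unitary // mxE [RHS]mxE.
  by move=> <-; apply: eq_bigr => k _; rewrite !mxE.
have [/existsP[k gt_k]|/existsPn le_d] := boolP [exists k, A i i < d 0 k].
  exists (d 0 k) => //; rewrite (perm_mem perm_ev).
  by apply/imageP; exists k.
have {}le_d k : d 0 k <= A i i by rewrite real_leNgt.
(* The weights (P k i)^* * P k i add up to 1, because P is unitary. *)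
have sum0 : \sum_k (P k i)^* * P k i * (A i i - d 0 k) = 0.
  rewrite (eq_bigr (fun k => (P k i)^* * P k i * A i i -
                               (P k i)^* * d 0 k * P k i)).
    by rewrite sumrB -mulr_suml ortho eqxx mul1r -entry subrr.
  by move=> k _; rewrite mulrBr [_ * d 0 k * _]mulrAC.
have term_ge0 k : true -> 0 <= (P k i)^* * P k i * (A i i - d 0 k).
  by move=> _; rewrite mulr_ge0 ?subr_ge0 // mulrC mul_conjC_ge0.
case/eqP: Aij; rewrite entry.
rewrite (eq_bigr (fun k => A i i * ((P k i)^* * P k j))).
  by rewrite -mulr_sumr ortho (negPf neq_ij) mulr0.
move=> k _; have /eqP := sum0; rewrite psumr_eq0 // => /allP/(_ k).
rewrite mem_index_enum => /(_ isT) /=; rewrite mulrC mulf_eq0 subr_eq0.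
case/orP=> [/eqP ->|]; first by rewrite mulrA [_ * d 0 k]mulrC.
rewrite mulrC mul_conjC_eq0 => /eqP ->.
by rewrite conjC0 !mul0r mulr0.
Qed.

(** In a decreasing sequence the entries above [z] come first and those below
[z] last; a position that belongs to neither block holds [z]. *)
Lemma nth_sorted_ge (C : numDomainType) (e : seq C) (z : C) p :
  sorted (fun x y => y <= x) e -> {in e, forall x, x \is Num.real} ->
  z \is Num.real ->
  (count (fun x => (z < x)%R) e <= p)%N ->
  (p + count (fun x => (x < z)%R) e < size e)%N -> e`_p = z.
Proof.
move=> se eR zR gt_p lt_p.
have lep : (p < size e)%N by apply: leq_ltn_trans lt_p; rewrite leq_addr.
have mono i j : (i <= j)%N -> (j < size e)%N -> e`_j <= e`_i.
  move=> le_ij lt_j; pose ge (x y : C) := y <= x.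
  have ge_tr : transitive ge by move=> y x t yx ty; apply: le_trans ty yx.
  have ge_refl : reflexive ge by move=> x; apply: lexx.
  apply: (sorted_leq_nth ge_tr ge_refl 0 se) => //; rewrite inE //.
  exact: leq_ltn_trans lt_j.
have zc : z >=< e`_p by apply: real_comparable => //; apply/eR/mem_nth.
case: (comparable_ltgtP zc) => // [gt_ep|lt_ep].
  suff : (p < count (fun x => (z < x)%R) e)%N by rewrite ltnNge gt_p.
  rewrite -(cat_take_drop p.+1 e) count_cat; apply: leq_trans (leq_addr _ _).
  have sz : size (take p.+1 e) = p.+1 by rewrite size_take_min (minn_idPl _).
  rewrite -[X in (X <= _)%N]sz.
  apply: eq_leq; apply/esym/eqP; rewrite -all_count.
  apply/(all_nthP 0) => i; rewrite sz => lt_i; rewrite nth_take //.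
  by apply: lt_le_trans gt_ep _; apply: mono.
suff : (size e <= p + count (fun x => (x < z)%R) e)%N by rewrite leqNgt lt_p.
rewrite -leq_subLR -{2}(cat_take_drop p e) count_cat -size_drop.
apply: leq_trans (leq_addl _ _).
apply: eq_leq; apply/esym/eqP; rewrite -all_count.
apply/(all_nthP 0) => i; rewrite size_drop => lt_i; rewrite nth_drop.
by apply: le_lt_trans lt_ep; apply: mono; rewrite ?leq_addr // -ltn_subRL.
Qed.

(** At most [r] eigenvalues differ from [A i i], and one of them is larger, so
at most [r.-1] are smaller: hence the asymmetric bounds on the position. *)
Lemma nth_eigenvalue (C : numClosedFieldType) n (A : 'M[C]_n) i j r p :
  A \is hermsymmx -> sorted (fun x y => y <= x) (eigenvalues A) ->
  i != j -> A i j != 0 ->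
  (\rank (A - (A i i)%:M)%R <= r)%N -> (r <= p)%N -> (p + r <= n)%N ->
  (eigenvalues A)`_p = A i i.
Proof.
move=> hA sA ij Aij le_rk le_rp le_pn; set z := A i i in le_rk *.
have zR : z \is Num.real.
  have /is_hermitianmxP/matrixP/(_ i i) := hA.
  by rewrite !mxE expr0 mul1r => /esym/CrealP.
have [t t_ev lt_zt] := eigenvalue_gt_diag hA ij Aij.
have := leq_trans (count_eigenvalues_neq z hA) le_rk.
set e := eigenvalues A in sA t_ev *.
have gt1 : (0 < count (fun x => (z < x)%R) e)%N.
  by rewrite -has_count; apply/hasP; exists t.
have -> : count (predC1 z) e =
    (count (fun x => (z < x)%R) e + count (fun x => (x < z)%R) e)%N.
  rewrite -count_predUI [X in (_ + X)%N](eq_count (a2 := pred0)).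
    rewrite count_pred0 addn0.
    apply: eq_in_count => x /(eigenvalues_hermsym_real hA) xR.
    by rewrite /= real_neqr_lt // orbC.
  by move=> x /=; apply/negP => /andP[/lt_trans h /h]; rewrite ltxx.
move=> le_r; apply: nth_sorted_ge => //.
- exact: eigenvalues_hermsym_real.
- by rewrite (leq_trans _ le_rp) // (leq_trans _ le_r) ?leq_addr.
rewrite size_eigenvalues; apply: leq_trans le_pn.
rewrite ltn_add2l; apply: leq_trans le_r.
by rewrite -[X in (X < _)%N]add0n ltn_add2r.
Qed.

(** * Laplacians and complements *)

(** The vertex [x] supplies a diagonal entry [d], and its neighbour a nonzero
entry in the same row. *)
Lemma mu_vertex_degree (C : numClosedFieldType) (G : sgraph) (x y : G) d r k :
  adj x y -> degree x = d -> (\rank (laplacian C G - d%:R%:M)%R <= r)%N ->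
  (r < k)%N -> (k + r <= #|G|.+1)%N -> mu C G k = d%:R.
Proof.
move=> adj_xy deg_x rk rk_k kn.
have Lxx : laplacian C G (enum_rank x) (enum_rank x) = d%:R.
  by rewrite !mxE enum_rankK adj_irrefl eqxx deg_x subr0.
have nxy : x != y by apply: contraTneq adj_xy => ->; rewrite adj_irrefl.
rewrite /mu -Lxx; apply: (@nth_eigenvalue _ _ _ _ (enum_rank y) r).
- exact: laplacian_hermsym.
- exact: laplacian_eigenvalues_sorted.
- by rewrite (inj_eq enum_rank_inj).
- rewrite !mxE !enum_rankK (inj_eq enum_rank_inj) (negPf nxy) adj_xy.
  by rewrite mulr0n sub0r oppr_eq0 oner_eq0.
- by rewrite Lxx.
- by rewrite -ltnS; case: k rk_k kn.
- by case: k rk_k kn.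
Qed.

Lemma num_components_le (G : sgraph) : (num_components G <= #|G|)%N.
Proof. exact: max_card. Qed.

Lemma degree_complement (G : sgraph) (x : G) :
  (degree x + @degree (complement G) x).+1 = #|G|.
Proof.
rewrite /degree -(cardsC [set y | adj x y]) -addnS; congr (_ + _)%N.
rewrite (cardsD1 x (~: _)) !inE adj_irrefl add1n; congr _.+1.
apply: eq_card => y; rewrite !inE /=.
by rewrite /compl_adj eq_sym.
Qed.

Lemma laplacian_complement (C : numClosedFieldType) (G : sgraph) :
  laplacian C (complement G) = #|G|%:R%:M - const_mx 1 - laplacian C G.
Proof.
apply/matrixP => i j; rewrite !mxE.
have -> : #|G|%:R = (@degree G (enum_val i))%:R +
    (@degree (complement G) (enum_val i))%:R + 1 :> C.
  by rewrite -natrD natr1 degree_complement.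
rewrite /= -(inj_eq enum_val_inj).
rewrite /compl_adj.
have [<-|_] /= := eqVneq (enum_val i) (enum_val j).
  by rewrite adj_irrefl !mulr1n !subr0 addrK addrAC subrr add0r.
by rewrite !mulr0n !sub0r opprK; case: (adj _ _); rewrite ?oppr0 ?addNr ?addr0.
Qed.

Lemma rank_outer (K : fieldType) n (u : 'cV[K]_n) (v : 'rV[K]_n) :
  (\rank (u *m v) <= 1)%N.
Proof. by rewrite (leq_trans (mxrankM_maxl _ _)) ?rank_leq_col. Qed.

Lemma rank_outer3 (K : fieldType) n
    (u1 u2 u3 : 'cV[K]_n) (v1 v2 v3 : 'rV[K]_n) :
  (\rank (u1 *m v1 + u2 *m v2 + u3 *m v3)%R <= 3)%N.
Proof.
apply: leq_trans (mxrank_add _ _) _; rewrite (leq_add (n1 := 2)) ?rank_outer //.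
by apply: leq_trans (mxrank_add _ _) _; rewrite (leq_add (n1 := 1)) ?rank_outer.
Qed.

(** * The complete balanced bipartite graph minus an edge *)

(** The parts are given by a predicate [p], with [a] in the part [p] and [b] in
the other, so that the description applies to any isomorphic copy of the graph
and does not depend on which part is listed first.  Vertices of opposite parts
that both lie in {a, b} are the two ends of the deleted edge. *)
Definition balanced_minus_edge (G : sgraph) (s : nat) (p : pred G) (a b : G) :=
  [/\ p a, ~~ p b, #|p| = s, #|[predC p]| = s &
      forall x y, adj x y =
        (p x != p y) && ~~ ((x \in pred2 a b) && (y \in pred2 a b))].

Section BalancedMinusEdge.

Variables (G : sgraph) (s : nat) (p : pred G) (a b : G).
Hypothesis hG : balanced_minus_edge s p a b.

Lemma card_vertices : #|G| = (s + s)%N.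
Proof. by have [_ _ sp sc _] := hG; rewrite -(cardC p) sp sc. Qed.

Lemma degree_minus_edge x : (degree x + (x \in pred2 a b))%N = s.
Proof.
have [pa pb sp sc adjE] := hG; rewrite /degree !inE.
have pE y : (y \in p) = p y by [].
have nab : b != a by apply: contraNneq pb => ->.
have [->|xa] /= := eqVneq x a.
  rewrite -sc [RHS](cardD1 b) !inE pb addnC; congr (_ + _)%N.
  apply: eq_card => y; rewrite !inE adjE !inE ?pE pa eqxx /=.
  have [->|ya] := eqVneq y a; first by rewrite pa /= ?andbF.
  by case: (y == b); case: (p y).
have [->|xb] /= := eqVneq x b.
  rewrite -sp [RHS](cardD1 a) pE pa addnC; congr (_ + _)%N.
  apply: eq_card => y; rewrite !inE adjE !inE ?pE.
  rewrite (negPf pb) eqxx (negPf nab) /=.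
  have [->|yb] := eqVneq y b; first by rewrite (negPf pb) /= ?andbF.
  by case: (y == a); case: (p y).
rewrite addn0; have [px|npx] := boolP (p x); [rewrite -sc|rewrite -sp];
  apply: eq_card => y; rewrite !inE adjE !inE ?pE (negPf xa);
  rewrite (negPf xb) ?px ?(negPf npx);
  by case: (p y).
Qed.

Variable C : numClosedFieldType.
Let ind (q : pred G) : 'cV[C]_#|G| := \col_i (q (enum_val i))%:R.
Let sgn : 'cV[C]_#|G| := ind (pred1 a) - ind (pred1 b).

(** The complete bipartite graph contributes the first two products.  The third
one is supported on the four entries indexed by [a] and [b], where it accounts
for the two degrees that drop and for the edge that disappears. *)
Lemma laplacian_minus_edge :
  laplacian C G - s%:R%:M =
    - (ind p *m (ind [predC p])^T + ind [predC p] *m (ind p)^T + sgn *m sgn^T).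
Proof.
have [pa pb sp sc adjE] := hG.
have pE y : (y \in p) = p y by [].
apply/matrixP => i j; rewrite !mxE !big_ord1 !mxE /=.
rewrite -(degree_minus_edge (enum_val i)) adjE natrD mulrnDl !inE !pE.
rewrite -(inj_eq enum_val_inj); set x := enum_val i; set y := enum_val j.
rewrite [_ - _ - _]addrAC opprD addrA subrr add0r -opprD; congr (- _).
have nab : (a == b) = false by apply: contraNF pb => /eqP <-.
have nba : (b == a) = false by rewrite eq_sym.
have cases z : [\/ z = a, z = b | (z == a) = false /\ (z == b) = false].
  have [|_] := eqVneq z a; first by constructor 1.
  by have [|_] := eqVneq z b; [constructor 2|constructor 3].
have [<-|nxy] := eqVneq x y.
  case: (cases x) => [->|->|[-> ->]];
    rewrite ?eqxx ?nab ?nba ?pa ?(negPf pb) /=.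
  - ring.
  - ring.
  by case: (p x) => /=; ring.
case: (cases x) nxy => [->|->|[-> ->]] nxy;
case: (cases y) nxy => [->|->|[-> ->]];
  rewrite ?eqxx ?nab ?nba ?pa ?(negPf pb) //= => _.
all: by case: (p x); case: (p y) => /=; ring.
Qed.

(** The cross terms between the two parts cancel against those of the all-ones
matrix, so the rank does not grow on passing to the complement. *)
Lemma laplacian_compl_minus_edge :
  laplacian C (complement G) - s%:R%:M =
    sgn *m sgn^T - ind p *m (ind p)^T - ind [predC p] *m (ind [predC p])^T.
Proof.
have ones : const_mx 1 =
    (ind p + ind [predC p]) *m (ind p + ind [predC p])^T :> 'M[C]_#|G|.
  apply/matrixP => i j; rewrite !mxE big_ord1 !mxE /=.
  rewrite -![_ \in p]/(p _).
  by case: (p (enum_val i)); case: (p (enum_val j)) => /=; ring.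
have -> : laplacian C (complement G) - s%:R%:M =
    - (laplacian C G - s%:R%:M) - const_mx 1 :> 'M[C]_#|G|.
  have cardE : #|G|%:R = s%:R + s%:R :> C by rewrite card_vertices natrD.
  rewrite laplacian_complement cardE; apply/matrixP => i j; rewrite !mxE.
  rewrite mulrnDl; ring.
rewrite laplacian_minus_edge ones opprK.
by apply/matrixP => i j; rewrite !(mxE, big_ord1) /=; ring.
Qed.

Lemma rank_laplacian_minus_edge :
  (\rank (laplacian C G - s%:R%:M)%R <= 3)%N.
Proof. by rewrite laplacian_minus_edge mxrank_opp rank_outer3. Qed.

Lemma rank_laplacian_compl_minus_edge :
  (\rank (laplacian C (complement G) - s%:R%:M)%R <= 3)%N.
Proof.
by rewrite laplacian_compl_minus_edge -!mulNmx rank_outer3.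
Qed.

Lemma other_left : (1 < s)%N -> exists2 x, p x & x != a.
Proof.
have [pa _ <- _ _] := hG; rewrite (cardD1 a) [a \in p]pa ltnS.
by case/card_gt0P => x /andP[/= xa px]; exists x.
Qed.

Lemma other_right : (1 < s)%N -> exists2 x, ~~ p x & x != b.
Proof.
have [_ pb _ <- _] := hG; rewrite (cardD1 b) [b \in _]pb ltnS.
by case/card_gt0P => x /andP[/= xa px]; exists x.
Qed.

Lemma connected_minus_edge : (1 < s)%N -> connected G.
Proof.
move=> s1; have [pa pb _ _ adjE] := hG.
split; first by rewrite card_vertices; case: (s) s1.
have csym : connect_sym (@adj G) by apply: sym_connect_sym; apply: adj_sym.
have [a' pa' aa'] := other_left s1; have [b' pb' bb'] := other_right s1.
have a'b : a' != b by apply: contraNneq pb => <-.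
have b'a : b' != a by apply: contraNneq pb' => ->.
have toa x : connect (@adj G) x a.
  have left y : p y -> connect (@adj G) y a.
    move=> py; apply: (@connect_trans _ _ b'); apply: connect1;
    by rewrite adjE ?py ?pa (negPf pb') !inE (negPf bb') (negPf b'a) ?andbF.
  have [/left //|px] := boolP (p x).
  apply: (@connect_trans _ _ a'); last exact: left.
  apply: connect1.
  by rewrite adjE pa' (negPf px) !inE (negPf aa') (negPf a'b) andbF.
by move=> x y; apply: (connect_trans (toa x)); rewrite csym.
Qed.

(** Each part is a clique of the complement, and the deleted edge joins them. *)
Lemma connected_compl_minus_edge : connected (complement G).
Proof.
have [pa pb sp sc adjE] := hG; split; first by apply/card_gt0P; exists a.
have csym : connect_sym (@adj (complement G)).
  by apply: sym_connect_sym; apply: adj_sym.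
have ba : connect (@adj (complement G)) b a.
  apply: connect1; rewrite /= /compl_adj adjE !inE !eqxx orbT andbF andbT.
  by apply: contraNneq pb => ->.
have same x y : p x = p y -> connect (@adj (complement G)) x y.
  have [->//|xy pxy] := eqVneq x y.
  by apply: connect1; rewrite /= /compl_adj adjE xy pxy eqxx.
have toa x : connect (@adj (complement G)) x a.
  have [px|px] := boolP (p x); first by apply: same; rewrite px pa.
  by apply: connect_trans ba; apply: same; rewrite (negPf px) (negPf pb).
by move=> x y; apply: (connect_trans (toa x)); rewrite csym.
Qed.

(** The vertices that are not ends of the deleted edge have degree [s]; in the
part of [a] there is one, adjacent to [b], because [1 < s]. *)
Lemma mu_minus_edge k : (1 < s)%N -> (3 < k)%N -> (k.+1 < #|G|)%N ->
  mu C G k = s%:R.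
Proof.
move=> s1 k3 kn; have [pa pb sp sc adjE] := hG.
have [x px xa] := other_left s1.
have xb : x != b by apply: contraNneq pb => <-.
apply: (@mu_vertex_degree C G x b s 3) => //.
- by rewrite adjE px (negPf pb) !inE (negPf xa) (negPf xb).
- by rewrite -[RHS](degree_minus_edge x) !inE (negPf xa) (negPf xb) addn0.
- exact: rank_laplacian_minus_edge.
- by rewrite addn3 !ltnS.
Qed.

(** In the complement it is the ends of the deleted edge that have degree [s]:
the [s.-1] other vertices of the part, and the opposite end. *)
Lemma mu_compl_minus_edge k : (3 < k)%N -> (k.+1 < #|G|)%N ->
  mu C (complement G) k = s%:R.
Proof.
move=> k3 kn; have [pa pb sp sc adjE] := hG.
apply: (@mu_vertex_degree C (complement G) a b s 3) => //.
- rewrite /= /compl_adj adjE !inE !eqxx orbT andbF andbT.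
  by apply: contraNneq pb => <-.
- have := degree_complement a.
  by rewrite card_vertices -(degree_minus_edge a) !inE eqxx /=; lia.
- exact: rank_laplacian_compl_minus_edge.
- by rewrite addn3 !ltnS.
Qed.

End BalancedMinusEdge.

(** An isomorphism carries the parts and the deleted edge to [F].  The part of
[a] is named [p], since [a] may lie in either part. *)
Lemma del_edge_balanced (s : nat) (a b : complete_bipartite s s) (F : sgraph) :
  adj a b -> isomorphic F (del_edge a b) ->
  exists p : pred F, exists a' b' : F, balanced_minus_edge s p a' b'.
Proof.
move=> hab [f [g fK gK] f_adj].
pose side (u : complete_bipartite s s) := if u is inl _ then true else false.
pose q u := side u == side a.
have adjE u v : adj u v = (q u != q v).
  by rewrite /q; case: u v a {hab f g fK gK f_adj q} => [?|?] [?|?] [?|?].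
have card_inl : #|[pred u | side u]| = s.
  rewrite -[RHS]card_ord -(card_codom (@inl_inj 'I_s 'I_s)).
  apply: eq_card => -[i|i]; rewrite inE /=; first by rewrite codom_f.
  by apply/esym/codomP => -[].
have card_inr : #|[pred u | ~~ side u]| = s.
  rewrite -[RHS]card_ord -(card_codom (@inr_inj 'I_s 'I_s)).
  apply: eq_card => -[i|i]; rewrite inE /=; last by rewrite codom_f.
  by apply/esym/codomP => -[].
have card_f (r : pred (complete_bipartite s s)) : #|[pred x | r (f x)]| = #|r|.
  rewrite -(card_image (can_inj gK) r); apply: eq_card => x; rewrite !inE.
  apply/idP/imageP => [rx|[u ru ->]].
    by exists (f x); rewrite ?fK.
  by rewrite gK.
exists (q \o f), (g a), (g b); split; rewrite /= ?gK.
- by rewrite /q.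
- by move: hab; rewrite adjE {1}/q eqxx; case: (q b).
- rewrite (card_f q) /q.
  case: (side a); [rewrite -[RHS]card_inl|rewrite -[RHS]card_inr];
  by apply: eq_card => u; rewrite [LHS]unfold_in inE /=; case: (side u).
- rewrite (card_f (predC q)) /q.
  case: (side a); [rewrite -[RHS]card_inr|rewrite -[RHS]card_inl];
  by apply: eq_card => u; rewrite [LHS]unfold_in inE /=; case: (side u).
move=> x y; rewrite -f_adj /= /del_edge_adj adjE.
have [//|/= neq_q] := eqVneq (q (f x)) (q (f y)).
have neq_f : f x != f y by apply: contraNneq neq_q => ->.
have nab : a != b by apply: contraTneq hab => ->; rewrite adj_irrefl.
rewrite eqEcard !cards2 neq_f nab leqnn andbT subUset !sub1set !inE.
by rewrite -!(inj_eq (can_inj fK)) !gK.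
Qed.

Theorem proposition2 (C : numClosedFieldType) (m : nat) (hm : (2 <= m)%N)
  (a b : complete_bipartite (2 * m)%N (2 * m)%N) (hab : adj a b)
  (F : sgraph) (hF : isomorphic F (del_edge a b)) :
  let n := (4 * m)%N in
  let k := (3 * m)%N in
  [/\ #|F| = n,
      connected F /\ connected (complement F),
      mu C F k * mu C (complement F) k = n%:R * (n%:R - k%:R) &
      forall H : sgraph, #|H| = (n - k)%N -> (k + 1 <= num_components H)%N ->
        ~ isomorphic F (join (complete k) H) /\
        ~ isomorphic (complement F) (join (complete k) H)].
Proof.
move=> n k; have [p [a' [b' hG]]] := del_edge_balanced hab hF.
have cardF : #|F| = n by rewrite (card_vertices hG) /n; lia.
split=> //.
- split; last exact: connected_compl_minus_edge hG.
  by apply: (connected_minus_edge hG); lia.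
- rewrite (mu_minus_edge hG) ?(mu_compl_minus_edge hG) ?cardF /n /k; try lia.
  rewrite !natrM; ring.
move=> H cardH comp; have := leq_trans comp (num_components_le H).
by rewrite cardH /n /k; lia.
Qed.
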